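(* Let $k\ge0$, $1\le i\le n+1$ and $N=\binom{n-1+k}{k}$. For $1\le s\le N$ and $1\le l\le n$ define $$\boldsymbol\phi_{F_i}^{s,l}:=\frac1{|F_i|}\sum_{1\le j\le n+1,\,j\ne i}\frac{\alpha_{ij}^l}{t_{ij}\cdot\nu_{F_i}}\lambda_j\varphi_{j,s}^{\hat0,\hat i}\,t_{ij}t_{ij}^T,$$ where the numbers $\alpha_{ij}^l$ satisfy $\sum_{1\le j\le n+1,\,j\ne i}\alpha_{ij}^lt_{ij}=e_l$, and $\varphi_{j,s}^{\hat0,\hat i}\in\mathcal P_k^{\hat0,\hat i}(K;\mathbb R)$ are uniquely determined by $$\frac1{|F_i|}\int_{F_i}\lambda_j\,\varphi_{j,s}^{\hat0,\hat i}\,\varphi_{F_i,t}=\delta_{st},\qquad t=1,\dots,N.$$ Then the $\boldsymbol\phi_{F_i}^{s,l}$ are the basis functions of $\tilde\Sigma_{k+1,h,F_i}(K)$ associated with (i.e. dual to) the degrees of freedom $N_{F_i}^{t,m}$: $$N_{F_i}^{t,m}(\boldsymbol\phi_{F_i}^{s,l})=\delta_{st}\delta_{lm},\qquad 1\le s,t\le N,\ 1\le l,m\le n.$$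
   Context: Let $n\ge2$ and let $K\subset\mathbb R^n$ be an $n$-simplex with vertices $a_1,\dots,a_{n+1}$ and barycentric coordinates $\lambda_1,\dots,\lambda_{n+1}$. $F_i$ is the face not containing $a_i$, with measure $|F_i|$ and unit normal $\nu_{F_i}$; $t_{ij}=(a_j-a_i)/|a_j-a_i|$; $e_1,\dots,e_n$ are the standard unit vectors of $\mathbb R^n$. $\mathcal P_k(F_i;\mathbb R)$ is the space of polynomials of degree $\le k$ on $F_i$, and $\mathcal P_k^{\hat0,\hat i}(K;\mathbb R):=\mathrm{span}\{\prod_{l=1,l\ne i}^{n+1}\lambda_l^{m_l}:\sum_{l\neq i}m_l=k\}$. The local face-bubble space of $F_i$ is $$\tilde\Sigma_{k+1,h,F_i}(K):=\bigoplus_{j=1,j\ne i}^{n+1}\lambda_j\mathcal P_k^{\hat0,\hat i}(K;\mathbb R)\,t_{ij}t_{ij}^T.$$ $\{\varphi_{F_i,t}\}_{t=1}^{N}$ is a basis of $\mathcal P_k(F_i;\mathbb R)$ normalized by $\frac1{|F_i|}\int_{F_i}\varphi_{F_i,t}^2=1$. The degrees of freedom are $$N_{F_i}^{t,m}(\boldsymbol\tau):=\int_{F_i}\boldsymbol\tau\nu_{F_i}\varphi_{F_i,t}\cdot e_m,\qquad t=1,\dots,N,\ m=1,\dots,n.$$ *)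

(* Defs.v *)
From HB Require Import structures.
From mathcomp Require Import all_boot all_order all_algebra.
From mathcomp Require Import all_classical all_reals all_analysis.
Set Implicit Arguments.
Unset Strict Implicit.
Unset Printing Implicit Defensive.
Import Order.TTheory GRing.Theory Num.Theory.
Local Open Scope classical_set_scope.
Local Open Scope ring_scope.

(* Euclidean geometry: the norm `|_| carried by matrices in MathComp-Analysis
   is the sup norm, hence the explicit inner product. *)

Definition dot (R : realType) (n : nat) (u v : 'cV[R]_n) : R :=
  \sum_r u r 0 * v r 0.

Definition enorm (R : realType) (n : nat) (u : 'cV[R]_n) : R :=
  Num.sqrt (dot u u).

Definition std_unit (R : realType) (n : nat) (l : 'I_n) : 'cV[R]_n :=
  delta_mx l 0.

Definition affinely_independent (R : realType) (n m : nat)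
    (a : 'I_m -> 'cV[R]_n) : Prop :=
  forall w : 'I_m -> R,
    \sum_j w j = 0 -> \sum_j w j *: a j = 0 -> forall j, w j = 0.

Definition conv_hull (R : realType) (n m : nat) (a : 'I_m -> 'cV[R]_n)
    : set 'cV[R]_n :=
  [set x | exists w : 'I_m -> R,
     [/\ forall j, 0 <= w j, \sum_j w j = 1 & x = \sum_j w j *: a j]].

Definition barycentric (R : realType) (n m : nat) (a : 'I_m -> 'cV[R]_n)
    (lam : 'I_m -> 'cV[R]_n -> R) : Prop :=
  forall x, \sum_j lam j x = 1 /\ \sum_j lam j x *: a j = x.

Definition face_vertices (R : realType) (n m : nat)
    (a : 'I_m.+1 -> 'cV[R]_n) (i : 'I_m.+1) : 'I_m -> 'cV[R]_n :=
  fun k => a (lift i k).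

Definition face (R : realType) (n m : nat) (a : 'I_m.+1 -> 'cV[R]_n)
    (i : 'I_m.+1) : set 'cV[R]_n :=
  conv_hull (face_vertices a i).

Definition unit_normal (R : realType) (n : nat) (F : set 'cV[R]_n)
    (nu : 'cV[R]_n) : Prop :=
  enorm nu = 1 /\ forall x y, F x -> F y -> dot nu (x - y) = 0.

Definition unit_tangent (R : realType) (n m : nat) (a : 'I_m -> 'cV[R]_n)
    (i j : 'I_m) : 'cV[R]_n :=
  (enorm (a j - a i))^-1 *: (a j - a i).

(* m-dimensional Lebesgue measure, as an iterated product measure *)

Definition tuple_cons (R : realType) (m : nat)
    (p : measurableTypeR R * m.-tuple (measurableTypeR R)) :
    m.+1.-tuple (measurableTypeR R) :=
  [the m.+1.-tuple (measurableTypeR R) of p.1 :: p.2].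

Fixpoint lebesgue_tuple (R : realType) (m : nat) :
    set (m.-tuple (measurableTypeR R)) -> \bar R :=
  match m with
  | 0 => dirac [tuple]
  | m'.+1 => pushforward (lebesgue_measure \x @lebesgue_tuple R m')%E
               (@tuple_cons R m')
  end.
Arguments lebesgue_tuple : clear implicits.

Lemma measurable_tuple_cons (R : realType) (m : nat) :
  measurable_fun setT (@tuple_cons R m).
Proof. exact: measurable_cons. Qed.

Definition tuple_uncons (R : realType) (m : nat)
    (t : m.+1.-tuple (measurableTypeR R)) :
    measurableTypeR R * m.-tuple (measurableTypeR R) :=
  (thead t, [tuple of behead t]).

Lemma measurable_tuple_uncons (R : realType) (m : nat) :
  measurable_fun setT (@tuple_uncons R m).
Proof.
apply/measurable_fun_pairP; split.
  exact: (@measurable_tnth _ (measurableTypeR R) m.+1 ord0).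
exact: measurable_behead.
Qed.

Lemma tuple_consK (R : realType) (m : nat) :
  cancel (@tuple_cons R m) (@tuple_uncons R m).
Proof. by case=> x t; congr pair; apply: val_inj. Qed.

Lemma product_sigma_finite d1 d2 (T1 : measurableType d1)
    (T2 : measurableType d2) (R : realType)
    (m1 : {sigma_finite_measure set T1 -> \bar R})
    (m2 : {sigma_finite_measure set T2 -> \bar R}) :
  sigma_finite setT (m1 \x m2)%E.
Proof.
have /sigma_finiteP[F [TF ndF Foo]] := sigma_finiteT m1.
have /sigma_finiteP[G [TG ndG Goo]] := sigma_finiteT m2.
exists (fun n => F n `*` G n).
  rewrite -setXTT TF TG predeqE => -[x y]; split.
    move=> [/= [n _ Fnx] [k _ Gky]]; exists (maxn n k) => //; split.
    - by move: x Fnx; exact/subsetPset/ndF/leq_maxl.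
    - by move: y Gky; exact/subsetPset/ndG/leq_maxr.
  by move=> [n _ []/= ? ?]; split; exists n.
move=> k; have [? ?] := Foo k; have [? ?] := Goo k.
split; first exact: measurableX.
by rewrite product_measure1E// lte_mul_pinfty// ge0_fin_numE.
Qed.

Section sigma_finite_of.
Context d (T : measurableType d) (R : realType)
  (mu : {measure set T -> \bar R}) (mu_sigma_finite : sigma_finite setT mu).

Definition measure_copy : set T -> \bar R := mu.

HB.instance Definition _ := Measure.on measure_copy.
HB.instance Definition _ :=
  Measure_isSigmaFinite.Build _ _ _ measure_copy mu_sigma_finite.

Lemma sigma_finite_measureP :
  exists nu : {sigma_finite_measure set T -> \bar R},
    (mu : set T -> \bar R) = nu.
Proof. by exists measure_copy. Qed.

End sigma_finite_of.

Lemma lebesgue_tupleP (R : realType) (m : nat) :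
  exists mu : {sigma_finite_measure set (m.-tuple (measurableTypeR R))
                 -> \bar R}, lebesgue_tuple R m = mu.
Proof.
elim: m => [|m [mu IH]].
  pose mu0 : {sigma_finite_measure set (0.-tuple (measurableTypeR R))
                -> \bar R} := dirac [tuple].
  by exists mu0.
pose leb : {sigma_finite_measure set (measurableTypeR R) -> \bar R} :=
  lebesgue_measure.
have LE : lebesgue_tuple R m.+1 = pushforward (leb \x mu)%E (@tuple_cons R m).
  by rewrite /= IH.
have mc := @measurable_tuple_cons R m.
have P3 : sigma_finite setT (lebesgue_tuple R m.+1).
  have [F UF mF] := product_sigma_finite leb mu.
  exists (fun n => @tuple_uncons R m @^-1` F n).
    by rewrite -preimage_bigcup -UF preimage_setT.
  move=> n; have [mFn nuF] := mF n; split.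
    by rewrite -[X in measurable X]setTI; exact: measurable_tuple_uncons.
  rewrite LE /pushforward -comp_preimage.
  rewrite (_ : _ \o _ = id) ?preimage_id//.
  by apply/funext => p /=; rewrite tuple_consK.
by rewrite LE in P3 *; exact: sigma_finite_measureP P3.
Qed.

Section lebesgue_tuple_measure.
Context (R : realType) (m : nat).

Let lebesgue_tuple0 : lebesgue_tuple R m set0 = 0%E.
Proof. by have [mu ->] := lebesgue_tupleP R m; exact: measure0. Qed.

Let lebesgue_tuple_ge0 A : (0 <= lebesgue_tuple R m A)%E.
Proof. by have [mu ->] := lebesgue_tupleP R m; exact: measure_ge0. Qed.

Let lebesgue_tuple_sigma_additive : semi_sigma_additive (lebesgue_tuple R m).
Proof.
by have [mu ->] := lebesgue_tupleP R m; exact: measure_semi_sigma_additive.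
Qed.

HB.instance Definition _ := isMeasure.Build _ _ _ (lebesgue_tuple R m)
  lebesgue_tuple0 lebesgue_tuple_ge0 lebesgue_tuple_sigma_additive.

Let lebesgue_tuple_sigma_finite : sigma_finite setT (lebesgue_tuple R m).
Proof. by have [mu ->] := lebesgue_tupleP R m; exact: sigma_finiteT. Qed.

HB.instance Definition _ := Measure_isSigmaFinite.Build _ _ _
  (lebesgue_tuple R m) lebesgue_tuple_sigma_finite.

End lebesgue_tuple_measure.

(* Integral over an m-simplex of R^n with respect to its m-dimensional surface
   measure: by the area formula for the affine parametrization
   u |-> b_0 + \sum_k u_k (b_k - b_0) on {u >= 0, \sum_k u_k <= 1}, whose
   Jacobian is the square root of the Gram determinant of the edges. *)

Definition std_simplex (R : realType) (m : nat) :
    set (m.-tuple (measurableTypeR R)) :=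
  [set u | (forall k, 0 <= (tnth u k : R)) /\ \sum_k (tnth u k : R) <= 1].

Definition simplex_param (R : realType) (n m : nat)
    (b : 'I_m.+1 -> 'cV[R]_n) (u : m.-tuple (measurableTypeR R)) : 'cV[R]_n :=
  b ord0 + \sum_k (tnth u k : R) *: (b (lift ord0 k) - b ord0).

Definition edge_matrix (R : realType) (n m : nat)
    (b : 'I_m.+1 -> 'cV[R]_n) : 'M[R]_(n, m) :=
  \matrix_(r, k) (b (lift ord0 k) - b ord0) r 0.

Definition simplex_integral (R : realType) (n m : nat)
    (b : 'I_m.+1 -> 'cV[R]_n) (f : 'cV[R]_n -> R) : R :=
  Num.sqrt (\det ((edge_matrix b)^T *m edge_matrix b)) *
  \int[lebesgue_tuple R m]_(u in @std_simplex R m) f (simplex_param b u).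

Definition face_integral (R : realType) (n m : nat)
    (a : 'I_m.+2 -> 'cV[R]_n) (i : 'I_m.+2) (f : 'cV[R]_n -> R) : R :=
  simplex_integral (face_vertices a i) f.

Definition face_measure (R : realType) (n m : nat)
    (a : 'I_m.+2 -> 'cV[R]_n) (i : 'I_m.+2) : R :=
  face_integral a i (fun=> 1).

(* mpoly is imported only here, and without its notations: these clash with
   MathComp-Analysis, and its module Measure shadows the measure structure. *)
From mathcomp Require Import -(notations) mpoly.

(* Function spaces.  A function on a subset D of R^n is represented by its
   extension by zero f \_ D, so that equality of such functions is equality
   on D. *)

Lemma restrictE0 (R : realType) (n : nat) (D : set 'cV[R]_n)
    (f : 'cV[R]_n -> R^o) (x : 'cV[R]_n) :
  (f \_ D) x = if x \in D then f x else 0.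
Proof. by []. Qed.

Definition lin_span (R : realType) (V : lmodType R) (S : set V) : set V :=
  [set v | exists (p : nat) (c : 'I_p -> R) (w : 'I_p -> V),
     (forall r, S (w r)) /\ v = \sum_r c r *: w r].

Definition is_basis (R : realType) (V : lmodType R) (S : set V)
    (I : finType) (v : I -> V) : Prop :=
  [/\ forall r, S (v r),
      forall c : I -> R, \sum_r c r *: v r = 0 -> forall r, c r = 0
    & forall x, S x -> exists c : I -> R, x = \sum_r c r *: v r].

(* mmeasure mdeg p is 1 + the total degree of p (and 0 if p = 0). *)
Definition poly_on (R : realType) (n : nat) (D : set 'cV[R]_n) (k : nat)
    : set ('cV[R]_n -> R^o) :=
  [set f | exists p : mpoly n R, (mmeasure mdeg p <= k.+1)%N /\
     f = (fun x => meval (fun r => x r 0) p : R^o) \_ D].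

(* The space written P_k^{\hat 0, \hat i}(K) in the paper: homogeneous of
   degree k in the barycentric coordinates other than lam i. *)
Definition bary_homog (R : realType) (n m : nat) (K : set 'cV[R]_n)
    (lam : 'I_m -> 'cV[R]_n -> R) (i : 'I_m) (k : nat)
    : set ('cV[R]_n -> R^o) :=
  lin_span [set f | exists e : 'I_m -> nat, (\sum_(l | l != i) e l)%N = k /\
     f = (fun x => \prod_(l | l != i) lam l x ^+ e l : R^o) \_ K].

(* The sum over j is direct, see tangent_tensors_free below. *)
Definition face_bubbles (R : realType) (n m : nat) (a : 'I_m -> 'cV[R]_n)
    (lam : 'I_m -> 'cV[R]_n -> R) (i : 'I_m) (k : nat)
    : set ('cV[R]_n -> 'M[R]_n) :=
  [set tau | exists q : 'I_m -> 'cV[R]_n -> R^o,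
     (forall j, j != i -> bary_homog (conv_hull a) lam i k (q j)) /\
     tau = fun x => \sum_(j | j != i) (lam j x * q j x) *:
                      (unit_tangent a i j *m (unit_tangent a i j)^T)].

Lemma dot_eq0 (R : realType) (n : nat) (u : 'cV[R]_n) :
  (dot u u == 0) = (u == 0).
Proof.
apply/idP/eqP => [|->]; last first.
  by rewrite /dot big1// => r _; rewrite mxE mul0r.
rewrite /dot psumr_eq0 => [/allP u0|r _]; last by rewrite -expr2 sqr_ge0.
apply/matrixP => r c; rewrite ord1 mxE; apply/eqP.
by have := u0 r (mem_index_enum r); rewrite mulf_eq0 orbb.
Qed.

Lemma affinely_independent_edges (R : realType) (n m : nat)
    (a : 'I_m -> 'cV[R]_n) (i : 'I_m) (c : 'I_m -> R) :
  affinely_independent a ->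
  \sum_(j | j != i) c j *: (a j - a i) = 0 -> forall j, j != i -> c j = 0.
Proof.
move=> ha c0 j ji.
pose w j := if j == i then - \sum_(l | l != i) c l else c j.
have wi l : l != i -> w l = c l by rewrite /w => /negbTE ->.
have sw : \sum_(l | l != i) w l = \sum_(l | l != i) c l by exact: eq_bigr.
rewrite -wi//; apply: ha; first by rewrite (bigD1 i)//= sw /w eqxx addNr.
rewrite (bigD1 i)//= (_ : w i = - \sum_(l | l != i) c l); last first.
  by rewrite /w eqxx.
rewrite -[RHS]c0 scaleNr scaler_suml addrC -sumrB.
by apply: eq_bigr => l li; rewrite wi// scalerBr.
Qed.

Lemma tangent_tensors_free (R : realType) (n m : nat) (a : 'I_m -> 'cV[R]_n)
    (i : 'I_m) (c : 'I_m -> R) :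
  affinely_independent a ->
  \sum_(j | j != i) c j *: (unit_tangent a i j *m (unit_tangent a i j)^T) = 0 ->
  forall j, j != i -> c j = 0.
Proof.
move=> ha c0 k ki; set t := unit_tangent a i in c0.
have edge0 : a k - a i != 0.
  apply/eqP => aki.
  suff /(affinely_independent_edges ha)/(_ k ki)/eqP :
      \sum_(j | j != i) (j == k)%:R *: (a j - a i) = 0.
    by rewrite eqxx oner_eq0.
  rewrite (bigD1 k)//= aki scaler0 add0r big1// => j /andP[_ /negbTE ->].
  by rewrite scale0r.
have norm0 : (enorm (a k - a i))^-1 != 0.
  rewrite invr_eq0 sqrtr_eq0 -ltNge lt0r dot_eq0 edge0/=.
  by apply: sumr_ge0 => r _; rewrite -expr2 sqr_ge0.
have tk0 : dot (t k) (t k) != 0.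
  by rewrite dot_eq0 scaler_eq0 negb_or norm0.
have /(_ k ki)/eqP : forall j, j != i ->
    c j * dot (t j) (t k) * (enorm (a j - a i))^-1 = 0.
  apply: (affinely_independent_edges ha).
  transitivity ((\sum_(j | j != i) c j *: (t j *m (t j)^T)) *m t k); last first.
    by rewrite c0 mul0mx.
  rewrite mulmx_suml; apply: eq_bigr => j ji.
  rewrite -scalemxAl -mulmxA.
  have -> : (t j)^T *m t k = (dot (t j) (t k))%:M.
    apply/matrixP => r s; rewrite !ord1 !mxE eqxx mulr1n.
    by apply: eq_bigr => l _; rewrite mxE.
  by rewrite mul_mx_scalar -/(t j) /t /unit_tangent !scalerA.
by rewrite !mulf_eq0 (negbTE tk0) (negbTE norm0) !orbF => /eqP.
Qed.

Definition face_dof (R : realType) (n m : nat) (a : 'I_m.+2 -> 'cV[R]_n)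
    (i : 'I_m.+2) (nu : 'cV[R]_n) (phi : 'cV[R]_n -> R) (l : 'I_n)
    (tau : 'cV[R]_n -> 'M[R]_n) : R :=
  face_integral a i (fun x => dot (phi x *: (tau x *m nu)) (std_unit R l)).

Definition face_shape (R : realType) (n m : nat) (a : 'I_m.+2 -> 'cV[R]_n)
    (lam : 'I_m.+2 -> 'cV[R]_n -> R) (i : 'I_m.+2) (nu : 'cV[R]_n)
    (alpha : 'I_m.+2 -> R) (q : 'I_m.+2 -> 'cV[R]_n -> R^o)
    : 'cV[R]_n -> 'M[R]_n :=
  fun x => (face_measure a i)^-1 *: \sum_(j | j != i)
    (alpha j / dot (unit_tangent a i j) nu * (lam j x * q j x)) *:
      (unit_tangent a i j *m (unit_tangent a i j)^T).

(* Main.v *)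
Require Import Defs.
From mathcomp Require Import all_boot all_order all_algebra.
From mathcomp Require Import all_classical all_reals all_analysis.
From mathcomp Require Import measurable_realfun zify ring lra.
From mathcomp Require Import -(notations) mpoly.
Set Implicit Arguments.
Unset Strict Implicit.
Unset Printing Implicit Defensive.
Import Order.TTheory GRing.Theory Num.Theory.
Import numFieldNormedType.Exports.
Local Open Scope classical_set_scope.
Local Open Scope ring_scope.

(** Write F for the face [face a i], K for the simplex [conv_hull a], H for the
    space [bary_homog K lam i k] of forms of degree k in the barycentric
    coordinates other than [lam i], and t_j for [unit_tangent a i j].

    The theorem rests on one bilinear pairing for each vertex j <> i, namely
    the mean over F of [lam j * q * phi], with q in H and phi a polynomial of
    degree at most k on F.  Two facts identify H with the polynomials of degree
    at most k on F.  Restriction to F is injective on H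
    ([bary_homog_face_inj]), because a form is determined on K by its values on
    F through the radial projection from the vertex a_i.  It is also onto
    ([poly_on_homogenize]), because on F the coordinates other than [lam i] sum
    to 1, so that each monomial can be multiplied by a power of that sum to
    become homogeneous of degree k.

    The pairing is then nondegenerate ([pairing_nondegenerate]).  If q pairs to
    zero with the basis phi_s, it pairs to zero with its own restriction to F;
    the integral of [lam j * q ^+ 2] over F vanishes, and since [lam j] is
    positive in the interior of F, the polynomial q vanishes on F
    ([simplex_integral_weighted_sqr_eq0]).  Consequently the square matrix of
    the pairings of homogenized phi_r with phi_s is invertible, which gives the
    existence of the dual functions ([dual_exists]); nondegeneracy gives their
    uniqueness and the expansion of any q in H along them
    ([dual_expansion]).

    The geometry enters through two remarks.  Since [t *m t^T *m nu] equals
    [dot t nu *: t], the degrees of freedom of a bubble are explicit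
    combinations of pairings ([face_dof_bubble]), and dividing by [dot t_j nu],
    which is nonzero ([tangent_dot_normal_neq0]), turns the duality relation
    into the hypothesis that the sum of the [alpha l j *: t_j] is the unit
    vector e_l.  Duality implies linear independence.  For spanning, the matrix
    of the alpha is inverse to the matrix of the tangents on both sides
    ([tangent_coef_inverse]), and a bubble is the combination of shape
    functions whose coefficients are its degrees of freedom. *)

(** * Lebesgue measure on the standard simplex *)

Definition cube (R : realType) (m : nat) (c : 'I_m -> R) (e : R) :
    set (m.-tuple (measurableTypeR R)) :=
  [set u | forall k, ball (c k) e (tnth u k : R)].

Lemma measurable_cube (R : realType) (m : nat) (c : 'I_m -> R) (e : R) :
  measurable (cube c e).
Proof.
have -> : cube c e = \bigcap_(k in [set: 'I_m])
    ((@tnth m (measurableTypeR R) ^~ k) @^-1` ball (c k) e).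
  by apply/seteqP; split => [u uc k _|u uc k]; exact: uc.
apply: fin_bigcap_measurable => [|k _]; first exact: finite_finset.
rewrite -[X in measurable X]setTI.
apply: (@measurable_tnth _ (measurableTypeR R)) => //.
by rewrite ball_itv; exact: measurable_itv.
Qed.

(** Cubes of positive side have positive finite measure: finiteness bounds the
    measure of the standard simplex, positivity shows that a property true
    almost everywhere holds somewhere in every small cube. *)
Lemma lebesgue_tuple_cube (R : realType) (m : nat) (c : 'I_m -> R) (e : R) :
  0 <= e -> lebesgue_tuple R m (cube c e) = ((e *+ 2) ^+ m)%:E.
Proof.
move=> e0; elim: m c => [|m IH] c.
  rewrite /= diracE mem_set//.
  by case.
rewrite /= /pushforward.
have -> : @tuple_cons R m @^-1` cube c e =
    ball (c ord0) e `*` cube (fun k => c (lift ord0 k)) e.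
  apply/seteqP; split => [[x u] xu|[x u] [/= xc uc] k].
    split => /= [|k]; first exact: (xu ord0).
    by have := xu (lift ord0 k); rewrite /= tnthS.
  by case: (unliftP ord0 k) => [j|] ->; rewrite ?tnthS.
rewrite product_measure1E; [|by rewrite ball_itv|exact: measurable_cube].
transitivity ((e *+ 2)%:E * ((e *+ 2) ^+ m)%:E)%E; last by rewrite exprS EFinM.
by congr (_ * _)%E; [exact: lebesgue_measure_ball|exact: IH].
Qed.

Lemma measurable_std_simplex (R : realType) (m : nat) :
  measurable (@std_simplex R m).
Proof.
have mt (k : 'I_m) : measurable_fun setT
    ((fun u => tnth u k) : m.-tuple (measurableTypeR R) -> R).
  exact: (@measurable_tnth _ (measurableTypeR R)).
have -> : @std_simplex R m =
    \bigcap_(k in [set: 'I_m]) [set u | 0 <= (tnth u k : R)] `&`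
    [set u | \sum_k (tnth u k : R) <= 1].
  apply/seteqP; split => [u [u0 u1]|u [u0 u1]].
    by split => // k _; exact: u0.
  by split => // k; exact: u0.
apply: measurableI.
  apply: fin_bigcap_measurable => [|k _]; first exact: finite_finset.
  by rewrite -[X in measurable X]setTI; exact: measurable_fun_le.
rewrite -[X in measurable X]setTI; apply: measurable_fun_le => //.
exact: measurable_sum.
Qed.

Lemma std_simplex_coord (R : realType) (m : nat)
    (u : m.-tuple (measurableTypeR R)) (k : 'I_m) :
  std_simplex u -> 0 <= (tnth u k : R) <= 1.
Proof.
move=> [u0 u1]; rewrite u0/=; apply: le_trans u1.
by rewrite (bigD1 k)//= lerDl; exact: sumr_ge0.
Qed.

Lemma lebesgue_std_simplex_fin (R : realType) (m : nat) :
  (lebesgue_tuple R m (@std_simplex R m) < +oo)%E.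
Proof.
apply: (@le_lt_trans _ _ (lebesgue_tuple R m (cube (fun=> 0) 2%:R))).
  apply: le_measure; rewrite ?inE; [exact: measurable_std_simplex|
    exact: measurable_cube|].
  move=> u /std_simplex_coord uk k; have /andP[u0 u1] := uk k.
  by rewrite /ball/= sub0r normrN ger0_norm//; lra.
by rewrite lebesgue_tuple_cube ?ltry.
Qed.

Lemma integrable_simplex (R : realType) (m : nat)
    (g : m.-tuple (measurableTypeR R) -> R) (M : R) :
  measurable_fun setT g -> (forall u, std_simplex u -> `|g u| <= M) ->
  (lebesgue_tuple R m).-integrable (@std_simplex R m) (fun u => (g u)%:E).
Proof.
move=> mg bg; apply: measurable_bounded_integrable.
- exact: measurable_std_simplex.
- exact: lebesgue_std_simplex_fin.
- exact: measurable_funTS.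
- exists M; split; first exact: num_real.
  by move=> N MN u uS; exact: le_trans (bg u uS) (ltW MN).
Qed.

(** A nonnegative function with zero integral vanishes almost everywhere, hence
    somewhere in each cube, as cubes are not negligible. *)
Lemma integral_eq0_zero_in_cube (R : realType) (m : nat)
    (g : m.-tuple (measurableTypeR R) -> R) (M : R) (c : 'I_m -> R) (e : R) :
  measurable_fun setT g -> (forall u, std_simplex u -> `|g u| <= M) ->
  (forall u, std_simplex u -> 0 <= g u) ->
  \int[lebesgue_tuple R m]_(u in @std_simplex R m) g u = 0 ->
  0 < e -> cube c e `<=` @std_simplex R m ->
  exists2 u, cube c e u & g u = 0.
Proof.
move=> mg bg g0 ig0 e0 cS; apply: contrapT => ng.
have int_g := integrable_simplex mg bg.
have mS := @measurable_std_simplex R m.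
have : (\int[lebesgue_tuple R m]_(u in @std_simplex R m) `|(g u)%:E|)%E = 0%E.
  rewrite (eq_integral (fun u => (g u)%:E)); last first.
    by move=> u /[!inE] uS; rewrite gee0_abs// lee_fin g0.
  rewrite -[LHS]fineK; last exact: integrable_fin_num.
  by congr EFin.
have mgS : measurable_fun (@std_simplex R m) (fun u => (g u)%:E).
  by apply/measurable_EFinP; exact: measurable_funTS.
have [+ _] := ae_eq_integral_abs (lebesgue_tuple R m) mS mgS.
move=> /[apply] -[N [mN N0 gN]].
have : (lebesgue_tuple R m (cube c e) <= lebesgue_tuple R m N)%E.
  apply: le_measure; rewrite ?inE//; first exact: measurable_cube.
  move=> u uc; apply: gN => /= /(_ (cS _ uc)) [gu].
  by apply: ng; exists u.
rewrite N0 lebesgue_tuple_cube; last exact: ltW.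
by rewrite lee_fin leNgt exprn_gt0// mulrn_wgt0.
Qed.

(** * Polynomial functions *)

Section polynomials.
Context (R : realType) (n : nat).
Implicit Types p : mpoly n R.

Lemma measurable_meval d (T : measurableType d) (v : 'I_n -> T -> R) p :
  (forall r, measurable_fun setT (v r)) ->
  measurable_fun setT (fun u => meval (fun r => v r u) p).
Proof.
move=> mv; rewrite (_ : (fun _ => _) = fun u =>
  \sum_(m <- msupp p) mcoeff m p * \prod_r v r u ^+ m r); last first.
  by apply/funext => u; rewrite mevalE.
apply: measurable_sum => m; apply: measurable_funM => //.
by apply: measurable_prod => r _; exact: measurable_funX.
Qed.

Lemma continuous_meval (T : topologicalType) (v : 'I_n -> T -> R) p :
  (forall r, continuous (v r)) ->
  continuous (fun u => meval (fun r => v r u) p).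
Proof.
move=> cv; rewrite (_ : (fun _ => _) = fun u =>
  \sum_(m <- msupp p) mcoeff m p * \prod_r v r u ^+ m r); last first.
  by apply/funext => u; rewrite mevalE.
apply: continuous_big => [|m _ u]; first exact: add_continuous.
apply: cvgM; first exact: cvg_cst.
apply: (@continuous_big _ _ _ _ 1); first exact: mul_continuous.
move=> r _ {}u; exact: (continuous_comp (cv r u) (@exprn_continuous _ _ _)).
Qed.

Lemma meval_bounded p (M : R) :
  exists N, forall v, (forall r, `|v r| <= M) -> `|meval v p| <= N.
Proof.
exists (\sum_(m <- msupp p) `|mcoeff m p| * \prod_r M ^+ m r).
move=> v vM; rewrite mevalE; apply: le_trans (ler_norm_sum _ _ _) _.
apply: ler_sum => m _; rewrite normrM ler_wpM2l// normr_prod.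
by apply: ler_prod => r _; rewrite normr_ge0 normrX lerXn2r ?nnegrE//
  (le_trans _ (vM r)).
Qed.

End polynomials.

(** The functions of the finite element spaces are extended by zero outside
    their domain, so they are polynomial only relative to a set. *)
Definition polynomial_on (R : realType) (n : nat) (D : set 'cV[R]_n)
    (h : 'cV[R]_n -> R) : Prop :=
  exists p : mpoly n R, forall x, D x -> h x = meval (fun r => x r 0) p.

Section polynomial_on.
Context (R : realType) (n : nat) (D : set 'cV[R]_n).
Implicit Types h : 'cV[R]_n -> R.

Lemma polynomial_on_cst c : polynomial_on D (fun=> c).
Proof. by exists (mpolyC n c) => x _; rewrite mevalC. Qed.

Lemma polynomial_onD h1 h2 : polynomial_on D h1 -> polynomial_on D h2 ->
  polynomial_on D (fun x => h1 x + h2 x).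
Proof.
by move=> [p hp] [q hq]; exists (p + q) => x Dx; rewrite mevalD hp// hq.
Qed.

Lemma polynomial_onM h1 h2 : polynomial_on D h1 -> polynomial_on D h2 ->
  polynomial_on D (fun x => h1 x * h2 x).
Proof.
by move=> [p hp] [q hq]; exists (p * q) => x Dx; rewrite mevalM hp// hq.
Qed.

Lemma polynomial_on_sum (I : finType) (P : pred I) (h : I -> 'cV[R]_n -> R) :
  (forall i, P i -> polynomial_on D (h i)) ->
  polynomial_on D (fun x => \sum_(i | P i) h i x).
Proof.
move=> hP; rewrite (_ : (fun _ => _) = \sum_(i | P i) h i); last first.
  by apply/funext => x; rewrite fct_sumE.
apply: big_ind => //; first exact: polynomial_on_cst.
by move=> f g; exact: polynomial_onD.
Qed.

End polynomial_on.

(** * Integrals of polynomials over an affine simplex *)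

(** Moving u slightly towards the barycenter of the simplex makes all the
    defining inequalities strict, with a margin that leaves room for a cube.
    Hence points of the boundary are also limits of cubes of the interior. *)
Lemma simplex_cube (R : realType) (m : nat) (u : 'I_m -> R) (delta : R) :
  (forall k, 0 <= u k) -> \sum_k u k <= 1 -> 0 < delta ->
  exists (c : 'I_m -> R) (e : R), 0 < e /\
    forall v : 'I_m -> R, (forall k, `|c k - v k| < e) ->
      [/\ forall k, 0 < v k, \sum_k v k < 1 & forall k, `|u k - v k| < delta].
Proof.
move=> u0 u1 d0; pose M : R := m.+1%:R.
have M1 : 1 <= M by rewrite ler1n.
have M0 : 0 < M by exact: lt_le_trans M1.
have Mm : M = m%:R + 1 by rewrite /M -natr1.
(* The center c of the cube is u moved towards the barycenter, whose coordinates
   are all M^-1, by the proportion eta * M.  Each inequality then holds at c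
   with margin eta, and e := eta / M is so small that the m < M coordinates
   together move by less than eta within the cube. *)
pose eta := Num.min 2^-1 (delta / 3) / M.
have eta0 : 0 < eta.
  apply: divr_gt0; last by [].
  by rewrite lt_min; apply/andP; split; lra.
have etaM : eta * M = Num.min 2^-1 (delta / 3).
  by rewrite divfK// gt_eqF.
have etaM1 : eta * M <= 2^-1 by rewrite etaM ge_min lexx.
have etaM2 : eta * M <= delta / 3 by rewrite etaM ge_min lexx orbT.
have e0 : 0 < eta / M by rewrite divr_gt0.
have eM : eta / M * M = eta by rewrite divfK// gt_eqF.
have e_eta : eta / M <= eta by rewrite ler_pdivrMr// ler_peMr// ltW.
set e := eta / M in e0 eM e_eta *.
have uk1 k : u k <= 1.
  by apply: le_trans u1; rewrite (bigD1 k)//= lerDl; exact: sumr_ge0.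
exists (fun k => (1 - eta * M) * u k + eta), e; split => // v vc.
have vE k : (1 - eta * M) * u k + eta - e < v k < (1 - eta * M) * u k + eta + e.
  by have := vc k; rewrite ltr_norml => /andP[? ?]; lra.
split=> [k||k].
- have /andP[+ _] := vE k; apply: le_lt_trans.
  have : 0 <= (1 - eta * M) * u k by rewrite mulr_ge0//; lra.
  lra.
- have : \sum_k v k <= \sum_k ((1 - eta * M) * u k + (eta + e)).
    by apply: ler_sum => k _; have /andP[_ /ltW] := vE k; rewrite addrA.
  move/le_lt_trans; apply.
  rewrite big_split/= -mulr_sumr sumr_const card_ord -[in X in _ + X]mulr_natr.
  have : (1 - eta * M) * \sum_k u k <= 1 - eta * M.
    by rewrite ler_piMr//; lra.
  have -> : m%:R = M - 1 by rewrite Mm addrK.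
  have -> : (eta + e) * (M - 1) = eta * M - e.
    by rewrite mulrDl !mulrBr eM; lra.
  lra.
- have /andP[l r] := vE k.
  have a : 0 <= eta * M by rewrite mulr_ge0// ltW.
  have a0 : 0 <= eta * M * u k by rewrite mulr_ge0.
  have a1 : eta * M * u k <= eta * M by rewrite ler_piMr.
  have a2 : eta <= eta * M by rewrite ler_peMr// ltW.
  rewrite ltr_norml; lra.
Qed.

Section simplex_integral.
Context (R : realType) (n m : nat) (b : 'I_m.+1 -> 'cV[R]_n).
Implicit Types (h : 'cV[R]_n -> R) (u : m.-tuple (measurableTypeR R)).

Lemma simplex_param_weights u : exists w : 'I_m.+1 -> R,
  [/\ w ord0 = 1 - \sum_k (tnth u k : R), forall k, w (lift ord0 k) = tnth u k,
      \sum_j w j = 1 & \sum_j w j *: b j = simplex_param b u].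
Proof.
have [w w0 wl] : exists2 w : 'I_m.+1 -> R,
    w ord0 = 1 - \sum_k (tnth u k : R) & forall k, w (lift ord0 k) = tnth u k.
  exists (fun j => if unlift ord0 j is Some k then tnth u k
                   else 1 - \sum_k (tnth u k : R)).
    by rewrite unlift_none.
  by move=> k; rewrite liftK.
exists w; split; rewrite ?big_ord_recl ?w0//.
  by rewrite [X in _ + X](eq_bigr (fun k => tnth u k : R)) ?subrK.
rewrite [X in _ + X](eq_bigr (fun k => (tnth u k : R) *: b (lift ord0 k))).
  rewrite /simplex_param; under [in RHS]eq_bigr do rewrite scalerBr.
  by rewrite sumrB -scaler_suml scalerBl scale1r addrA addrAC.
by move=> k _; rewrite wl.
Qed.

Lemma simplex_param_hull u :
  std_simplex u -> conv_hull b (simplex_param b u).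
Proof.
move=> [u0 u1]; have [w [w0 wl w1 wb]] := simplex_param_weights u.
exists w; split => // j.
by case: (unliftP ord0 j) => [k|] ->; rewrite ?wl ?w0// subr_ge0.
Qed.

Lemma hull_simplex_param x : conv_hull b x ->
  exists2 u, std_simplex u & x = simplex_param b u.
Proof.
move=> [w [w0 w1 ->]].
have w1' : w ord0 = 1 - \sum_k w (lift ord0 k).
  by rewrite -w1 big_ord_recl addrK.
exists [tuple w (lift ord0 k) | k < m].
  split => [k|]; first by rewrite tnth_mktuple.
  under eq_bigr do rewrite tnth_mktuple.
  by rewrite -subr_ge0 -w1'.
rewrite /simplex_param big_ord_recl w1' scalerBl scale1r.
under [in RHS]eq_bigr do rewrite tnth_mktuple scalerBr.
by rewrite sumrB -scaler_suml addrA [RHS]addrAC.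
Qed.

Lemma simplex_paramE u r : simplex_param b u r 0 =
  b ord0 r 0 + \sum_k (tnth u k : R) * (b (lift ord0 k) - b ord0) r 0.
Proof.
by rewrite mxE summxE; congr (_ + _); apply: eq_bigr => k _; rewrite mxE.
Qed.

Lemma measurable_simplex_meval (p : mpoly n R) :
  measurable_fun setT (fun u => meval (fun r => simplex_param b u r 0) p).
Proof.
apply: (measurable_meval (v := fun r u => simplex_param b u r 0)) => r.
under eq_fun do rewrite simplex_paramE.
apply: measurable_funD => //; apply: measurable_sum => k.
apply: measurable_funM => //; exact: (@measurable_tnth _ (measurableTypeR R)).
Qed.

Lemma bounded_simplex_meval (p : mpoly n R) : exists M, forall u,
  std_simplex u -> `|meval (fun r => simplex_param b u r 0) p| <= M.
Proof.
pose M := \sum_r (`|b ord0 r 0| +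
  \sum_(k < m) `|(b (lift ord0 k) - b ord0) r 0|).
have [N NM] := meval_bounded p M; exists N => u uS; apply: NM => r.
rewrite /M (bigD1 r)//= -[leLHS]addr0; apply: lerD; last first.
  by apply: sumr_ge0 => s _; apply: addr_ge0 => //; exact: sumr_ge0.
rewrite simplex_paramE; apply: le_trans (ler_normD _ _) _.
rewrite lerD2l; apply: le_trans (ler_norm_sum _ _ _) _; apply: ler_sum => k _.
have /andP[u0 u1] := std_simplex_coord k uS.
by rewrite normrM ler_piMl// ger0_norm.
Qed.

Lemma eq_simplex_integral h1 h2 :
  (forall x, conv_hull b x -> h1 x = h2 x) ->
  simplex_integral b h1 = simplex_integral b h2.
Proof.
move=> h12; congr (_ * _); apply: eq_Rintegral => u /[!inE] uS.
by rewrite h12//; exact: simplex_param_hull.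
Qed.

Lemma integrable_polynomial h : polynomial_on (conv_hull b) h ->
  (lebesgue_tuple R m).-integrable (@std_simplex R m)
    (EFin \o (fun u => h (simplex_param b u))).
Proof.
move=> [p hp]; have [M bM] := bounded_simplex_meval p.
apply: eq_integrable (integrable_simplex (measurable_simplex_meval p) bM).
  exact: measurable_std_simplex.
by move=> u /[!inE] uS /=; rewrite hp//; exact: simplex_param_hull.
Qed.

Lemma simplex_integralZ c h : polynomial_on (conv_hull b) h ->
  simplex_integral b (fun x => c * h x) = c * simplex_integral b h.
Proof.
move=> hp; rewrite /simplex_integral RintegralZl; first by rewrite mulrCA.
  exact: measurable_std_simplex.
exact: integrable_polynomial.
Qed.

Lemma simplex_integralD h1 h2 : polynomial_on (conv_hull b) h1 ->
  polynomial_on (conv_hull b) h2 ->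
  simplex_integral b (fun x => h1 x + h2 x) =
  simplex_integral b h1 + simplex_integral b h2.
Proof.
move=> hp1 hp2; rewrite /simplex_integral RintegralD; first by rewrite mulrDr.
- exact: measurable_std_simplex.
- exact: integrable_polynomial.
- exact: integrable_polynomial.
Qed.

Lemma simplex_integral0 : simplex_integral b (fun=> 0) = 0.
Proof.
have := simplex_integralZ 0 (polynomial_on_cst (conv_hull b) 0).
by rewrite !mul0r.
Qed.

Lemma simplex_integral_sum (I : finType) (P : pred I)
    (h : I -> 'cV[R]_n -> R) :
  (forall i, P i -> polynomial_on (conv_hull b) (h i)) ->
  simplex_integral b (fun x => \sum_(i | P i) h i x) =
  \sum_(i | P i) simplex_integral b (h i).
Proof.
move=> hP; rewrite (_ : (fun _ => _) = \sum_(i | P i) h i); last first.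
  by apply/funext => x; rewrite fct_sumE.
have [] // : polynomial_on (conv_hull b) (\sum_(i | P i) h i) /\
   simplex_integral b (\sum_(i | P i) h i) =
   \sum_(i | P i) simplex_integral b (h i).
pose K f y := polynomial_on (conv_hull b) f /\ simplex_integral b f = y.
apply: (big_rec2 K) => [|i f y Pi [fp <-]].
  by split; [exact: polynomial_on_cst|exact: simplex_integral0].
split; first by apply: polynomial_onD => //; exact: hP.
by rewrite -simplex_integralD//; exact: hP.
Qed.

(** If h were nonzero at some point, it would be nonzero on a neighborhood of it
    by continuity, and this neighborhood meets the interior of the simplex in a
    cube, on which the weight is positive; but the integrand has a zero in that
    cube. *)
Lemma simplex_integral_weighted_sqr_eq0 (w h : 'cV[R]_n -> R) :
  polynomial_on (conv_hull b) w -> polynomial_on (conv_hull b) h ->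
  (forall u, std_simplex u -> 0 <= w (simplex_param b u)) ->
  (forall u, (forall k, 0 < (tnth u k : R)) -> \sum_k (tnth u k : R) < 1 ->
     0 < w (simplex_param b u)) ->
  simplex_integral b (fun=> 1) != 0 ->
  simplex_integral b (fun x => w x * h x ^+ 2) = 0 ->
  forall x, conv_hull b x -> h x = 0.
Proof.
move=> [q hq] [p hp] w0 w_gt0 b0 /eqP wh x /hull_simplex_param[u uS ->{x}].
move: wh; rewrite mulf_eq0 (negbTE (_ : Num.sqrt _ != 0))/=; last first.
  by apply: contra_neq b0; rewrite /simplex_integral => ->; rewrite mul0r.
move=> /eqP wh; apply/eqP/negP => /negP hu.
(* The parametrization of the simplex, with a row vector as argument: unlike
   tuples, row vectors carry a topology in which p o v is continuous. *)
pose v (r : 'I_n) (y : 'rV[R]_m) : R :=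
  b ord0 r 0 + \sum_k y 0 k * (b (lift ord0 k) - b ord0) r 0.
pose row_of u : 'rV[R]_m := \row_k tnth u k.
have rowE u' : meval (fun r => v r (row_of u')) p =
    meval (fun r => simplex_param b u' r 0) p.
  apply: meval_eq => r; rewrite simplex_paramE /v; congr (_ + _).
  by apply: eq_bigr => k _; rewrite mxE.
have cv r : continuous (v r).
  move=> y; pose f (k : 'I_m) (y : 'rV[R]_m) :=
    y 0 k * (b (lift ord0 k) - b ord0) r 0.
  apply: (@continuousD _ _ _ (fun=> b ord0 r 0) (fun y => \sum_k f k y)).
    exact: cst_continuous.
  apply: (@continuous_big _ _ _ _ xpredT); first exact: add_continuous.
  move=> k _ {}y; apply: continuousM; last exact: cst_continuous.
  exact: coord_continuous.
have : \forall y \near row_of u, meval (fun r => v r y) p != 0.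
  have pc : {for row_of u, continuous (fun y => meval (v^~ y) p)}.
    exact: continuous_meval.
  apply: (cvgr_neq0 _ pc).
  by rewrite rowE -hp//; exact: simplex_param_hull.
move=> /nbhs_ballP[delta /= d0 nz].
have [u0 u1] := uS; have [c [e [e0 ce]]] := simplex_cube u0 u1 d0.
have cS : cube c e `<=` @std_simplex R m.
  move=> y yc; have [y0 y1 _] := ce _ yc.
  by split; [move=> k; exact: ltW|exact: ltW].
pose g y := meval (fun r => simplex_param b y r 0) (q * (p * p)).
have gE y : std_simplex y ->
    g y = w (simplex_param b y) * h (simplex_param b y) ^+ 2.
  move=> /simplex_param_hull yb.
  by rewrite /g !mevalM -hq// -hp// expr2.
have [M bM] := bounded_simplex_meval (q * (p * p)).
have [||y yc] :=
  integral_eq0_zero_in_cube (measurable_simplex_meval _) bM _ _ e0 cS.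
- by move=> y yS; rewrite -/(g y) gE// mulr_ge0 ?sqr_ge0 ?w0.
- rewrite -[RHS]wh; apply: eq_Rintegral => y /[!inE] yS.
  by rewrite -/(g y) gE.
have [y0 y1 yd] := ce _ yc.
rewrite -/(g y) gE; last exact: cS.
apply/eqP; apply: mulf_neq0; first by rewrite gt_eqF// w_gt0.
apply: expf_neq0.
rewrite hp; last by apply: simplex_param_hull; exact: cS.
rewrite -rowE; apply: nz.
by split => // i k; rewrite !mxE; exact: yd.
Qed.

End simplex_integral.

(** * Barycentric coordinates *)

Section barycentric_coordinates.
Context (R : realType) (n m : nat) (a : 'I_m -> 'cV[R]_n)
  (lam : 'I_m -> 'cV[R]_n -> R).
Hypotheses (a_free : affinely_independent a) (lamP : barycentric a lam).

Lemma barycentric_unique (w : 'I_m -> R) (x : 'cV[R]_n) :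
  \sum_j w j = 1 -> \sum_j w j *: a j = x -> forall j, lam j x = w j.
Proof.
move=> w1 wx j; have [l1 lx] := lamP x.
apply/eqP; rewrite -subr_eq0; apply/eqP.
apply: (a_free (w := fun j => lam j x - w j)).
  by rewrite sumrB l1 w1 subrr.
under eq_bigr do rewrite scalerBl.
by rewrite sumrB lx wx subrr.
Qed.

Lemma hull_barycentric_ge0 (x : 'cV[R]_n) :
  conv_hull a x -> forall j, 0 <= lam j x.
Proof.
by move=> [w [w0 w1 xw]] j; rewrite (barycentric_unique w1 (esym xw)).
Qed.

(** The affine function that interpolates [lam] at the origin and at the
    standard unit vectors also satisfies the equations that define barycentric
    coordinates, and affine independence makes their solution unique. *)
Lemma barycentric_affine (j : 'I_m) : exists p : mpoly n R,
  (mmeasure mdeg p <= 2)%N /\ forall x, lam j x = meval (fun r => x r 0) p.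
Proof.
pose c l (r : 'I_n) := lam l (delta_mx r 0) - lam l 0.
exists (mpolyC n (lam j 0) + \sum_(r < n) c j r *: mpolyX R (mnm1 r)); split.
  apply: leq_trans (mmeasureD_le _ _ _) _; rewrite geq_max; apply/andP; split.
    by rewrite mmeasureC; case: (_ == 0).
  apply: leq_trans (mmeasure_sum _ _ _ _) _; apply/bigmax_leqP => r _.
  by apply: leq_trans (mmeasureZ_le _ _ _) _; rewrite mmeasureX /= mdeg1.
move=> x; rewrite mevalD mevalC raddf_sum/=.
under eq_bigr do rewrite mevalZ mevalXU mulrC.
apply: (barycentric_unique (w := fun l => lam l 0 + \sum_r x r 0 * c l r)).
  have lam1 y : \sum_l lam l y = 1 by have [] := lamP y.
  rewrite big_split/= lam1 exchange_big/= big1 ?addr0// => r _.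
  by rewrite -mulr_sumr sumrB !lam1 subrr mulr0.
have lamE y : \sum_l lam l y *: a l = y by have [] := lamP y.
under eq_bigr do rewrite scalerDl scaler_suml.
rewrite big_split/= lamE add0r exchange_big/=.
have xE : x = \sum_r x r 0 *: delta_mx r 0.
  by rewrite [LHS]matrix_sum_delta; apply: eq_bigr => r _; rewrite big_ord1.
rewrite [RHS]xE; apply: eq_bigr => r _.
under eq_bigr do rewrite -scalerA.
rewrite -scaler_sumr; congr (_ *: _).
by under eq_bigr do rewrite scalerBl; rewrite sumrB !lamE subr0.
Qed.

End barycentric_coordinates.

(** * Linear spans and forms in barycentric coordinates *)

Section lin_span.
Context (R : realType) (V : lmodType R) (S : set V).

Lemma lin_span_comb (I : finType) (c : I -> R) (w : I -> V) :
  (forall r, S (w r)) -> lin_span S (\sum_r c r *: w r).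
Proof.
move=> Sw; exists #|I|, (c \o enum_val), (w \o enum_val); split => [r|].
  exact: Sw.
by rewrite (reindex (@enum_val I predT))//; exact/onW_bij/enum_val_bij.
Qed.

Lemma lin_span_mem w : S w -> lin_span S w.
Proof.
move=> Sw; have := @lin_span_comb 'I_1 (fun=> 1) (fun=> w) (fun=> Sw).
by rewrite big_ord1 scale1r.
Qed.

Lemma lin_span0 : lin_span S 0.
Proof. by exists 0%N, (fun=> 0), (fun=> 0); split; [case|rewrite big_ord0]. Qed.

Lemma lin_spanZ c v : lin_span S v -> lin_span S (c *: v).
Proof.
move=> [p [d [w [Sw ->]]]]; rewrite scaler_sumr.
under eq_bigr do rewrite scalerA.
exact: lin_span_comb.
Qed.

Lemma lin_spanD v1 v2 : lin_span S v1 -> lin_span S v2 -> lin_span S (v1 + v2).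
Proof.
move=> [p1 [c1 [w1 [Sw1 ->]]]] [p2 [c2 [w2 [Sw2 ->]]]].
pose c (r : 'I_p1 + 'I_p2) := match r with inl r => c1 r | inr r => c2 r end.
pose w (r : 'I_p1 + 'I_p2) := match r with inl r => w1 r | inr r => w2 r end.
have := @lin_span_comb _ c w.
by rewrite big_sumType/=; apply; case.
Qed.

Lemma lin_span_sum (I : finType) (P : pred I) (v : I -> V) :
  (forall r, P r -> lin_span S (v r)) -> lin_span S (\sum_(r | P r) v r).
Proof.
by move=> Sv; apply: big_ind => //; [exact: lin_span0|exact: lin_spanD].
Qed.

End lin_span.

Section bary_homog.
Context (R : realType) (n m : nat) (K : set 'cV[R]_n)
  (lam : 'I_m -> 'cV[R]_n -> R) (i : 'I_m).
Implicit Types (k : nat) (q : 'cV[R]_n -> R^o).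

Lemma bary_homog_monomial (e : 'I_m -> nat) :
  bary_homog K lam i (\sum_(l | l != i) e l)
    ((fun x => \prod_(l | l != i) lam l x ^+ e l : R^o) \_ K).
Proof. by apply: lin_span_mem; exists e. Qed.

Lemma bary_homog1 : bary_homog K lam i 0 ((fun=> 1 : R^o) \_ K).
Proof.
have := bary_homog_monomial (fun=> 0%N); rewrite big1//.
congr (bary_homog _ _ _ _ (_ \_ _)).
by apply/funext => x; rewrite big1.
Qed.

Lemma bary_homog_lam l : l != i ->
  bary_homog K lam i 1 ((lam l : _ -> R^o) \_ K).
Proof.
move=> li; have := bary_homog_monomial (fun l' => (l' == l) : nat).
rewrite (bigD1 l)//= eqxx big1 => [|l' /andP[_ /negbTE ->]//].
rewrite addn0; congr (bary_homog _ _ _ _ (_ \_ _)); apply/funext => x.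
rewrite (bigD1 l)//= eqxx expr1 big1 ?mulr1// => l' /andP[_ /negbTE ->].
by rewrite expr0.
Qed.

Lemma bary_homogM k1 k2 q1 q2 : bary_homog K lam i k1 q1 ->
  bary_homog K lam i k2 q2 ->
  bary_homog K lam i (k1 + k2) (fun x => q1 x * q2 x : R^o).
Proof.
move=> [p1 [c1 [w1 [Sw1 ->]]]] [p2 [c2 [w2 [Sw2 ->]]]].
rewrite (_ : (fun _ => _) = \sum_(r : 'I_p1 * 'I_p2)
    (c1 r.1 * c2 r.2) *: (fun x => w1 r.1 x * w2 r.2 x : R^o)).
  apply: lin_span_comb => r.
  have [e1 [<- ->]] := Sw1 r.1; have [e2 [<- ->]] := Sw2 r.2.
  exists (fun l => e1 l + e2 l)%N; rewrite big_split/=; split => //.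
  apply/funext => x; rewrite !restrictE0; case: ifP => _; last by rewrite mul0r.
  by rewrite -big_split/=; apply: eq_bigr => l _; rewrite exprD.
apply/funext => x; rewrite !fct_sumE mulr_suml.
under eq_bigr do rewrite mulr_sumr.
rewrite pair_big/=; apply: eq_bigr => r _.
by rewrite /= /GRing.scale/= mulrACA.
Qed.

Lemma bary_homog_outside k q x : bary_homog K lam i k q -> ~ K x -> q x = 0.
Proof.
move=> [p [c [w [Sw ->]]]] Kx; rewrite fct_sumE big1// => r _.
have [e [_ ->]] := Sw r.
by rewrite /= /GRing.scale/= restrictE0 memNset//; exact: mulr0.
Qed.

(** Euler homogeneity.  The scaling is that of the vector of barycentric
    coordinates other than [lam i], not of the point itself. *)
Lemma bary_homog_scale k q (s : R) x y : bary_homog K lam i k q ->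
  K x -> K y -> (forall l, l != i -> lam l x = s * lam l y) ->
  q x = s ^+ k * q y.
Proof.
move=> [p [c [w [Sw ->]]]] Kx Ky xy; rewrite !fct_sumE mulr_sumr.
apply: eq_bigr => r _; have [e [<- ->]] := Sw r.
rewrite /= /GRing.scale/= !restrictE0 !mem_set// mulrCA; congr (_ * _).
rewrite -prodrXr -big_split/=.
by apply: eq_bigr => l li; rewrite xy// exprMn.
Qed.

End bary_homog.

Section degree.
Context (R : realType) (n : nat) (D : set 'cV[R]_n).
Implicit Types (k : nat) (h : 'cV[R]_n -> R).

Lemma mmeasureM_le (p q : mpoly n R) (k1 k2 : nat) :
  (mmeasure mdeg p <= k1.+1)%N -> (mmeasure mdeg q <= k2.+1)%N ->
  (mmeasure mdeg (p * q) <= (k1 + k2).+1)%N.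
Proof.
have [->|p0] := eqVneq p 0; first by rewrite mul0r mmeasure0.
have [->|q0] := eqVneq q 0; first by rewrite mulr0 mmeasure0.
move=> pk qk; rewrite msizeM//.
by move: (mmeasure mdeg p) (mmeasure mdeg q) pk qk => s t; lia.
Qed.

Definition degree_le k h : Prop := exists p : mpoly n R,
  (mmeasure mdeg p <= k.+1)%N /\
  forall x, D x -> h x = meval (fun r => x r 0) p.

Lemma degree_le_cst k c : degree_le k (fun=> c).
Proof.
exists (mpolyC n c); split; first by rewrite mmeasureC; case: (_ == 0).
by move=> x _; rewrite mevalC.
Qed.

Lemma degree_leD k h1 h2 : degree_le k h1 -> degree_le k h2 ->
  degree_le k (fun x => h1 x + h2 x).
Proof.
move=> [p [pk hp]] [q [qk hq]]; exists (p + q); split.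
  by apply: leq_trans (mmeasureD_le _ _ _) _; rewrite geq_max pk.
by move=> x Dx; rewrite mevalD hp// hq.
Qed.

Lemma degree_leM k1 k2 h1 h2 : degree_le k1 h1 -> degree_le k2 h2 ->
  degree_le (k1 + k2) (fun x => h1 x * h2 x).
Proof.
move=> [p [pk hp]] [q [qk hq]]; exists (p * q); split.
  exact: mmeasureM_le.
by move=> x Dx; rewrite mevalM hp// hq.
Qed.

Lemma degree_leX k e h : degree_le k h -> degree_le (e * k) (fun x => h x ^+ e).
Proof.
move=> hk; elim: e => [|e IH]; first exact: degree_le_cst.
by under eq_fun do rewrite exprS; rewrite mulSn; exact: degree_leM.
Qed.

Lemma degree_le_prod (I : finType) (P : pred I) (h : I -> 'cV[R]_n -> R)
    (k : I -> nat) : (forall j, P j -> degree_le (k j) (h j)) ->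
  degree_le (\sum_(j | P j) k j) (fun x => \prod_(j | P j) h j x).
Proof.
move=> hk; rewrite (_ : (fun _ => _) = \prod_(j | P j) h j); last first.
  by apply/funext => x; rewrite fct_prodE.
apply: (big_rec2 (fun f d => degree_le d f)); first exact: degree_le_cst.
by move=> j d f Pj; apply: degree_leM; exact: hk.
Qed.

Lemma degree_le_sum k (I : finType) (P : pred I) (h : I -> 'cV[R]_n -> R) :
  (forall j, P j -> degree_le k (h j)) ->
  degree_le k (fun x => \sum_(j | P j) h j x).
Proof.
move=> hk; rewrite (_ : (fun _ => _) = \sum_(j | P j) h j); last first.
  by apply/funext => x; rewrite fct_sumE.
by apply: big_ind => //; [exact: degree_le_cst|move=> f g; exact: degree_leD].
Qed.

End degree.

Lemma bary_homog_degree (R : realType) (n m : nat) (K : set 'cV[R]_n)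
    (lam : 'I_m -> 'cV[R]_n -> R) (i : 'I_m) k (q : 'cV[R]_n -> R^o) :
  (forall l, degree_le K 1 (lam l)) -> bary_homog K lam i k q ->
  degree_le K k q.
Proof.
move=> lam1 [N [c [w [Sw ->]]]].
rewrite (_ : (\sum_r _) = fun x => \sum_r c r * w r x); last first.
  by apply/funext => x; rewrite fct_sumE.
apply: degree_le_sum => r _; rewrite -[k]add0n.
apply: degree_leM; first exact: degree_le_cst.
have [e [<- ->]] := Sw r.
have [p [pk hp]] : degree_le K (\sum_(l | l != i) e l)
    (fun x => \prod_(l | l != i) lam l x ^+ e l).
  apply: degree_le_prod => l _.
  by have := degree_leX (e l) (lam1 l); rewrite muln1.
by exists p; split => // x Kx; rewrite restrictE0 mem_set// hp.
Qed.

(** * Restriction of forms to a face *)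

Section simplex.
Context (R : realType) (n m : nat) (a : 'I_m.+2 -> 'cV[R]_n)
  (lam : 'I_m.+2 -> 'cV[R]_n -> R) (i : 'I_m.+2).
Hypotheses (a_free : affinely_independent a) (lamP : barycentric a lam).

Local Notation K := (conv_hull a).
Local Notation F := (face a i).

Lemma barycentric_face (w : 'I_m.+1 -> R) (x : 'cV[R]_n) :
  \sum_k w k = 1 -> \sum_k w k *: face_vertices a i k = x ->
  lam i x = 0 /\ forall k, lam (lift i k) x = w k.
Proof.
move=> w1 wx.
pose w' j := if unlift i j is Some k then w k else 0.
have w'i : w' i = 0 by rewrite /w' unlift_none.
have w'l k : w' (lift i k) = w k by rewrite /w' liftK.
have lw' : forall j, lam j x = w' j.
  apply: (barycentric_unique a_free lamP).
    rewrite (bigD1_ord i)//= w'i add0r -[RHS]w1.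
    by apply: eq_bigr => k _.
  rewrite (bigD1_ord i)//= w'i scale0r add0r -[RHS]wx.
  by apply: eq_bigr => k _; rewrite w'l.
by split => [|k]; rewrite lw'.
Qed.

Lemma face_barycentric x : F x -> lam i x = 0.
Proof. by move=> [w [_ w1 xw]]; have [] := barycentric_face w1 (esym xw). Qed.

Lemma face_sub_hull x : F x -> K x.
Proof.
move=> [w [w0 w1 xw]]; have [li ll] := barycentric_face w1 (esym xw).
have [l1 lx] := lamP x; exists (lam^~ x); split => // j.
by case: (unliftP i j) => [k|] ->; rewrite ?ll ?li.
Qed.

(** The point y is the projection of x onto the face from the opposite vertex.
    When x is that vertex the projection is undefined, but then both sides of
    the relation vanish for any y. *)
Lemma face_projection x : K x ->
  exists2 y, F y & forall l, l != i -> lam l x = (1 - lam i x) * lam l y.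
Proof.
move=> Kx; have l0 := hull_barycentric_ge0 a_free lamP Kx.
have [l1 _] := lamP x.
have sE : \sum_k lam (lift i k) x = 1 - lam i x.
  by rewrite -l1 (bigD1_ord i)//= [lam i x + _]addrC addrK.
suff [w w0 [w1 wE]] : exists2 w : 'I_m.+1 -> R, forall k, 0 <= w k &
    \sum_k w k = 1 /\ forall k, lam (lift i k) x = (1 - lam i x) * w k.
  exists (\sum_k w k *: face_vertices a i k); first by exists w.
  have [_ ll] := barycentric_face w1 erefl.
  move=> l; case: (unliftP i l) => [k|] ->; last by rewrite eqxx.
  by rewrite ll wE.
have [s0|s0] := eqVneq (1 - lam i x) 0.
  exists (fun k => (k == ord0)%:R); first by move=> k; case: (k == _).
  split; first by rewrite (bigD1 ord0)//= big1 ?addr0// => k /negbTE ->.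
  move=> k; rewrite s0 mul0r; apply/eqP.
  move: sE; rewrite s0 => /eqP; rewrite psumr_eq0// => /allP; apply.
  exact: mem_index_enum.
exists (fun k => lam (lift i k) x / (1 - lam i x)).
  by move=> k; rewrite divr_ge0// -sE sumr_ge0.
split; first by rewrite -mulr_suml sE divff.
by move=> k; rewrite mulrCA divff// mulr1.
Qed.

(** Along the rays issued from the vertex opposite to the face, a form is a
    multiple of its value on the face. *)
Lemma bary_homog_face_inj k (q : 'cV[R]_n -> R^o) : bary_homog K lam i k q ->
  (forall x, F x -> q x = 0) -> q = 0.
Proof.
move=> qk qF; apply/funext => x; case: (pselect (K x)) => [Kx|Kx]; last first.
  exact: bary_homog_outside qk Kx.
have [y Fy xy] := face_projection Kx.
by rewrite (bary_homog_scale qk Kx (face_sub_hull Fy) xy) qF// mulr0.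
Qed.

(** Degrees add up under products of such functions, so that polynomials can be
    homogenized one factor at a time. *)
Definition homogenizable k (h : 'cV[R]_n -> R) : Prop :=
  exists2 q, bary_homog K lam i k q & forall x, F x -> q x = h x.

Lemma homogenizableM k1 k2 h1 h2 : homogenizable k1 h1 -> homogenizable k2 h2 ->
  homogenizable (k1 + k2) (fun x => h1 x * h2 x).
Proof.
move=> [q1 q1k q1h] [q2 q2k q2h].
exists (fun x => q1 x * q2 x : R^o); first exact: bary_homogM.
by move=> x Fx; rewrite q1h// q2h.
Qed.

Lemma homogenizableZ k c h : homogenizable k h ->
  homogenizable k (fun x => c * h x).
Proof.
move=> [q qk qh]; exists (c *: q); first exact: lin_spanZ.
by move=> x Fx; rewrite /= -qh.
Qed.

Lemma homogenizableD k h1 h2 : homogenizable k h1 -> homogenizable k h2 ->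
  homogenizable k (fun x => h1 x + h2 x).
Proof.
move=> [q1 q1k q1h] [q2 q2k q2h]; exists (q1 + q2); first exact: lin_spanD.
by move=> x Fx; rewrite -q1h// -q2h.
Qed.

Lemma homogenizable0 k : homogenizable k (fun=> 0).
Proof.
by exists 0 => //; exact: lin_span0.
Qed.

Lemma homogenizable_affine (c : 'I_m.+2 -> R) :
  homogenizable 1 (fun x => \sum_(l | l != i) lam l x * c l).
Proof.
exists (\sum_(l | l != i) c l *: ((lam l : _ -> R^o) \_ K)).
  by apply: lin_span_sum => l li; apply: lin_spanZ; exact: bary_homog_lam.
move=> x Fx; rewrite fct_sumE; apply: eq_bigr => l li /=.
transitivity (c l * ((lam l : _ -> R^o) \_ K) x) => //.
rewrite restrictE0 mem_set; last exact: face_sub_hull.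
exact: mulrC.
Qed.

Lemma homogenizable_eq k h1 h2 : (forall x, F x -> h1 x = h2 x) ->
  homogenizable k h1 -> homogenizable k h2.
Proof. by move=> h12 [q qk qh]; exists q => // x Fx; rewrite qh// h12. Qed.

Lemma homogenizable_coord (r : 'I_n) : homogenizable 1 (fun x => x r 0).
Proof.
apply: homogenizable_eq (homogenizable_affine (fun l => a l r 0)) => x Fx.
have [_] := lamP x; rewrite (bigD1 i)//= (face_barycentric Fx) scale0r add0r.
move=> xE; rewrite -[in RHS]xE summxE.
by apply: eq_bigr => l _; rewrite mxE.
Qed.

(** On the face 1 is the sum of the barycentric coordinates other than [lam i],
    so it is also the k-th power of that sum. *)
Lemma homogenizable1 k : homogenizable k (fun=> 1).
Proof.
elim: k => [|k IH].
  exists ((fun=> 1 : R^o) \_ K); first exact: bary_homog1.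
  by move=> x Fx; rewrite restrictE0 mem_set//; exact: face_sub_hull.
rewrite -addn1.
apply: homogenizable_eq (homogenizableM IH (homogenizable_affine (fun=> 1))).
move=> x Fx; rewrite mul1r; have [l1 _] := lamP x.
rewrite -[RHS]l1 [RHS](bigD1 i)//= (face_barycentric Fx) add0r.
by apply: eq_bigr => l _; rewrite mulr1.
Qed.

Lemma homogenizableX e h : homogenizable 1 h ->
  homogenizable e (fun x => h x ^+ e).
Proof.
move=> h1; elim: e => [|e IH]; first exact: homogenizable1.
by under eq_fun do rewrite exprS; rewrite -add1n; exact: homogenizableM.
Qed.

(** Coordinates are linear forms in the barycentric coordinates, hence monomials
    of degree e are forms of degree e; the missing degree is supplied by
    [homogenizable1]. *)
Lemma homogenizable_meval k (p : mpoly n R) : (mmeasure mdeg p <= k.+1)%N ->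
  homogenizable k (fun x => meval (fun r => x r 0) p).
Proof.
move=> pk; apply: (@homogenizable_eq _ (\sum_(e <- msupp p | e \in msupp p)
    (fun x : 'cV[R]_n => mcoeff e p * \prod_r x r 0 ^+ e r))).
  by move=> x _; rewrite fct_sumE mevalE [RHS]big_seq.
apply: big_ind; [exact: homogenizable0|exact: homogenizableD|].
move=> e /mmeasure_mnm_lt/leq_trans/(_ pk); rewrite ltnS /= => ek.
apply: homogenizableZ; rewrite -(subnK ek).
apply: (@homogenizable_eq _ (fun x => 1 * \prod_r x r 0 ^+ e r)).
  by move=> x _; rewrite mul1r.
apply: homogenizableM; first exact: homogenizable1.
rewrite mdegE (_ : (fun _ => _) = \prod_r (fun x : 'cV[R]_n => x r 0 ^+ e r)).
  apply: (big_rec2 (fun h d => homogenizable d h)); first exact: homogenizable1.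
  move=> r d h _; apply: homogenizableM.
  exact/homogenizableX/homogenizable_coord.
by apply/funext => x; rewrite fct_prodE.
Qed.

Lemma poly_on_homogenize k (h : 'cV[R]_n -> R^o) : poly_on F k h ->
  exists2 q, bary_homog K lam i k q & forall x, F x -> q x = h x.
Proof.
move=> [p [pk ->]]; apply: homogenizable_eq (homogenizable_meval pk) => x Fx.
by rewrite restrictE0 mem_set.
Qed.

Lemma barycentric_degree l : degree_le K 1 (lam l).
Proof.
have [p [p2 lp]] := barycentric_affine a_free lamP l.
by exists p; split => // x _; exact: lp.
Qed.

Lemma bary_homog_poly_on k (q : 'cV[R]_n -> R^o) : bary_homog K lam i k q ->
  poly_on F k (q \_ F).
Proof.
move=> /(bary_homog_degree barycentric_degree)[p [pk qp]].
exists p; split => //.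
apply/funext => x; rewrite !restrictE0; case: ifPn => // /[!inE] Fx.
by rewrite qp//; exact: face_sub_hull.
Qed.

End simplex.

(** * Normals and tangents of a face *)

Section dot.
Context (R : realType) (n : nat).
Implicit Types u v w : 'cV[R]_n.

Lemma dotDl u v w : dot (u + v) w = dot u w + dot v w.
Proof.
by rewrite /dot -big_split/=; apply: eq_bigr => r _; rewrite mxE mulrDl.
Qed.

Lemma dotZl c u v : dot (c *: u) v = c * dot u v.
Proof. by rewrite /dot mulr_sumr; apply: eq_bigr => r _; rewrite mxE mulrA. Qed.

Lemma dotC u v : dot u v = dot v u.
Proof. by apply: eq_bigr => r _; rewrite mulrC. Qed.

Lemma dot_suml (I : finType) (P : pred I) (u : I -> 'cV[R]_n) v :
  dot (\sum_(j | P j) u j) v = \sum_(j | P j) dot (u j) v.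
Proof.
apply: (big_morph (fun w => dot w v)); first by move=> w1 w2; rewrite dotDl.
by rewrite /dot big1// => r _; rewrite mxE mul0r.
Qed.

Lemma dot_std_unit u l : dot u (std_unit R l) = u l 0.
Proof.
rewrite /dot (bigD1 l)//= !mxE !eqxx mulr1 big1 ?addr0// => r /negbTE rl.
by rewrite mxE rl mulr0.
Qed.

Lemma mul_tensor_vec u v : u *m u^T *m v = dot u v *: u.
Proof.
rewrite -mulmxA (_ : u^T *m v = (dot u v)%:M) ?mul_mx_scalar//.
apply/matrixP => r s; rewrite !ord1 !mxE eqxx mulr1n.
by apply: eq_bigr => l _; rewrite mxE.
Qed.

Lemma enorm_eq0 u : enorm u = 0 -> u = 0.
Proof.
move/eqP; rewrite sqrtr_eq0 => u0; apply/eqP; rewrite -dot_eq0.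
rewrite eq_le u0/=; apply: sumr_ge0 => r _; exact: sqr_ge0.
Qed.

End dot.

Lemma comb_funE (R : realType) (T : Type) (I : finType) (P : pred I)
    (c : I -> R) (q : I -> T -> R^o) (x : T) :
  (\sum_(s | P s) c s *: q s) x = \sum_(s | P s) c s * q s x.
Proof. by rewrite fct_sumE. Qed.

Section face_of_simplex.
Context (R : realType) (d : nat) (a : 'I_d.+2 -> 'cV[R]_d.+1) (i : 'I_d.+2)
  (nu : 'cV[R]_d.+1) (alpha : 'I_d.+1 -> 'I_d.+2 -> R).
Hypotheses (nuP : unit_normal (face a i) nu)
  (alphaP : forall l,
     \sum_(j | j != i) alpha l j *: unit_tangent a i j = std_unit R l).

Local Notation t := (unit_tangent a i).

Lemma vertex_in_face p : p != i -> face a i (a p).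
Proof.
case: (unliftP i p) => [k -> _|->]; last by rewrite eqxx.
exists (fun j => (j == k)%:R); split.
- by move=> j; case: (j == k).
- by rewrite (bigD1 k)//= eqxx big1 ?addr0// => j /negbTE ->.
- rewrite (bigD1 k)//= eqxx scale1r big1 ?addr0// => j /negbTE ->.
  by rewrite scale0r.
Qed.

(** The normal is orthogonal to the differences of vertices of the face; if it
    were orthogonal to one edge issued from the opposite vertex, it would be
    orthogonal to all of them, and these edges span the whole space. *)
Lemma tangent_dot_normal_neq0 j : j != i -> dot (t j) nu != 0.
Proof.
move=> ji; apply/eqP => tj0; have [nu1 nuF] := nuP.
have edge_j : dot (a j - a i) nu = 0.
  have [/enorm_eq0 ->|e0] := eqVneq (enorm (a j - a i)) 0.
    by rewrite /dot big1// => r _; rewrite mxE mul0r.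
  rewrite -[a j - a i](scalerK (invr_neq0 e0)).
  by rewrite dotZl -/(unit_tangent a i j) tj0 mulr0.
have t0 p : p != i -> dot (t p) nu = 0.
  move=> pi; rewrite dotZl -[a p](subrK (a j)) -addrA dotDl edge_j addr0 dotC.
  by rewrite nuF ?mulr0//; exact: vertex_in_face.
suff nu0 : nu = 0.
  move: nu1; rewrite nu0 /enorm /dot big1 ?sqrtr0 => [/eqP|r _].
    by rewrite eq_sym oner_eq0.
  by rewrite mxE mul0r.
apply/matrixP => l c; rewrite ord1 mxE -dot_std_unit dotC -alphaP dot_suml.
by apply: big1 => p pi; rewrite dotZl t0// mulr0.
Qed.

(** The hypothesis on alpha says that the matrix of the alpha is a left inverse
    of the square matrix of the tangents; it is then a right inverse. *)
Lemma tangent_coef_inverse p j : p != i -> j != i ->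
  \sum_l t p l 0 * alpha l j = (p == j)%:R.
Proof.
case: (unliftP i p) => [p' -> _|->]; last by rewrite eqxx.
case: (unliftP i j) => [j' -> _|->]; last by rewrite eqxx.
pose A : 'M[R]_d.+1 := \matrix_(l, k) alpha l (lift i k).
pose T : 'M[R]_d.+1 := \matrix_(k, r) t (lift i k) r 0.
have AT : A *m T = 1%:M.
  apply/matrixP => l r; transitivity (std_unit R l r 0); last first.
    by rewrite !mxE andbT eq_sym.
  rewrite -alphaP summxE mxE [RHS]big_mkcond [RHS](bigD1_ord i)//= eqxx add0r.
  by apply: eq_bigr => c _; rewrite eq_sym neq_lift !mxE.
have /matrixP/(_ p' j') := mulmx1C AT.
rewrite !mxE (inj_eq lift_inj) => <-.
by apply: eq_bigr => l _; rewrite !mxE.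
Qed.

End face_of_simplex.

(** * The weighted pairing on a face *)

Section duality.
Context (R : realType) (d k N : nat)
    (a : 'I_d.+2 -> 'cV[R]_d.+1) (a_free : affinely_independent a)
    (lam : 'I_d.+2 -> 'cV[R]_d.+1 -> R) (lamP : barycentric a lam)
    (i : 'I_d.+2) (phi : 'I_N -> 'cV[R]_d.+1 -> R^o)
    (phiP : is_basis (poly_on (face a i) k) phi)
    (face_neq0 : face_measure a i != 0).

Local Notation F := (face a i).
Local Notation H := (bary_homog (conv_hull a) lam i k).

Lemma bary_homog_polynomial_on_face q : H q -> polynomial_on F q.
Proof.
move=> /(bary_homog_degree (barycentric_degree a_free lamP))[p [_ qp]].
by exists p => x Fx; apply: qp; exact: face_sub_hull Fx.
Qed.

Lemma barycentric_polynomial_on_face j : polynomial_on F (lam j).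
Proof.
have [p [_ lp]] := barycentric_affine a_free lamP j.
by exists p => x _; exact: lp.
Qed.

Lemma basis_polynomial_on_face s : polynomial_on F (phi s).
Proof.
have [phiF _ _] := phiP; have [p [_ ->]] := phiF s.
by exists p => x Fx; rewrite restrictE0 mem_set.
Qed.

Definition pairing j (q h : 'cV[R]_d.+1 -> R^o) : R :=
  (face_measure a i)^-1 * face_integral a i (fun x => lam j x * q x * h x).

Lemma pairing_suml j (I : finType) (c : I -> R)
    (q : I -> 'cV[R]_d.+1 -> R^o) h :
  (forall s, H (q s)) -> polynomial_on F h ->
  pairing j (\sum_s c s *: q s) h = \sum_s c s * pairing j (q s) h.
Proof.
move=> qH hF; rewrite /pairing /face_integral.
under [in RHS]eq_bigr do rewrite mulrCA.
rewrite -mulr_sumr; congr (_ * _).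
have qhF s : polynomial_on F (fun x => lam j x * q s x * h x).
  apply: polynomial_onM => //; apply: polynomial_onM.
    exact: barycentric_polynomial_on_face.
  exact: bary_homog_polynomial_on_face.
under [in RHS]eq_bigr do rewrite -simplex_integralZ//.
rewrite -simplex_integral_sum => [|s _]; last first.
  by apply: polynomial_onM => //; exact: polynomial_on_cst.
apply: eq_simplex_integral => x _; rewrite comb_funE mulr_sumr mulr_suml.
by apply: eq_bigr => s _; rewrite mulrCA !mulrA.
Qed.

Lemma pairingZ j c (q h : 'cV[R]_d.+1 -> R^o) : H q -> polynomial_on F h ->
  pairing j (c *: q) h = c * pairing j q h.
Proof.
move=> qH hF.
have := @pairing_suml j 'I_1 (fun=> c) (fun=> q) h (fun=> qH) hF.
by rewrite !big_ord1.
Qed.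

(** The restriction of q to the face is a combination of the basis phi, so that
    q pairs to zero with itself: the integral of [lam j * q ^+ 2] is zero. *)
Lemma pairing_nondegenerate j q : j != i -> H q ->
  (forall s, pairing j q (phi s) = 0) -> q = 0.
Proof.
move=> ji qH q0; apply: (bary_homog_face_inj a_free lamP qH).
have [k' jk'] : exists k', j = lift i k'.
  by case: (unliftP i j) ji => [k' ->|->]; [exists k'|rewrite eqxx].
have [_ _ /(_ _ (bary_homog_poly_on a_free lamP qH))[c qc]] := phiP.
have qF := bary_homog_polynomial_on_face qH.
have lF := barycentric_polynomial_on_face j.
have lamE u (w : 'I_d.+1 -> R) : \sum_j w j = 1 ->
    \sum_j w j *: face_vertices a i j = simplex_param (face_vertices a i) u ->
    lam j (simplex_param (face_vertices a i) u) = w k'.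
  by rewrite jk' => w1 /(barycentric_face a_free lamP w1)[_ ->].
apply: (simplex_integral_weighted_sqr_eq0 lF qF) => // [u uS|u u0 u1|].
- apply: (hull_barycentric_ge0 a_free lamP).
  apply: (face_sub_hull a_free lamP (i := i)).
  exact: simplex_param_hull.
- have [w [w0 wl w1 wb]] := simplex_param_weights (face_vertices a i) u.
  rewrite (lamE _ _ w1 wb).
  by case: (unliftP ord0 k') => [r|] ->; rewrite ?wl ?w0// subr_gt0.
transitivity (simplex_integral (face_vertices a i)
    (fun x => \sum_s c s * (lam j x * q x * phi s x))).
  apply: eq_simplex_integral => x Fx.
  have qx : q x = \sum_s c s * phi s x.
    have /(congr1 (fun f => f x)) := qc.
    by rewrite restrictE0 mem_set// comb_funE.
  rewrite expr2 mulrA {2}qx mulr_sumr; apply: eq_bigr => s _.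
  by rewrite mulrCA.
rewrite simplex_integral_sum => [|s _].
  rewrite big1// => s _; rewrite simplex_integralZ.
    have /eqP := q0 s; rewrite /pairing mulf_eq0 invr_eq0 (negbTE face_neq0).
    by move=> /eqP; rewrite /face_integral => ->; rewrite mulr0.
  by apply: polynomial_onM (polynomial_onM _ _) (basis_polynomial_on_face s).
apply: polynomial_onM; first exact: polynomial_on_cst.
by apply: polynomial_onM (polynomial_onM _ _) (basis_polynomial_on_face s).
Qed.

Lemma pairing_dual_ext j (q1 q2 : 'cV[R]_d.+1 -> R^o) :
  j != i -> H q1 -> H q2 ->
  (forall s, pairing j q1 (phi s) = pairing j q2 (phi s)) -> q1 = q2.
Proof.
move=> ji q1H q2H q12; apply/eqP; rewrite -subr_eq0; apply/eqP.
pose q (b : bool) := if b then q1 else q2.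
pose c (b : bool) : R := if b then 1 else -1.
have -> : q1 - q2 = \sum_b c b *: q b.
  by rewrite big_bool/= scale1r scaleN1r.
have qH b : H (q b) by case: b.
apply: (pairing_nondegenerate ji).
  exact: lin_span_sum (fun b _ => lin_spanZ _ (qH b)).
move=> s; rewrite pairing_suml//; last exact: basis_polynomial_on_face.
by rewrite big_bool/= q12 mul1r mulN1r subrr.
Qed.

(** The matrix G of the pairings of homogenized basis functions with basis
    functions has trivial kernel, because the pairing is nondegenerate and the
    basis is free; the rows of its inverse are the coordinates of the dual
    functions. *)
Lemma dual_exists j s : j != i -> exists2 q, H q &
  forall s', pairing j q (phi s') = (s == s')%:R.
Proof.
move=> ji; have [phiF phi_free _] := phiP.
have /choice[Q QP] : forall r, exists q, H q /\ forall x, F x -> q x = phi r x.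
  move=> r; have [q qH qF] := poly_on_homogenize a_free lamP (phiF r).
  by exists q.
have QH r : H (Q r) by have [] := QP r.
have combH (c : 'I_N -> R) : H (\sum_r c r *: Q r).
  by apply: lin_span_sum => r _; exact: lin_spanZ (QH r).
pose G : 'M[R]_N := \matrix_(r, s') pairing j (Q r) (phi s').
have pairingG (c : 'I_N -> R) s' :
    pairing j (\sum_r c r *: Q r) (phi s') = \sum_r c r * G r s'.
  rewrite pairing_suml//; last exact: basis_polynomial_on_face.
  by apply: eq_bigr => r _; rewrite mxE.
have Gunit : G \in unitmx.
  rewrite -row_free_unit -kermx_eq0; apply/rowV0P => v /sub_kermxP vG.
  have v0 : \sum_r v 0 r *: Q r = 0.
    apply: (pairing_nondegenerate ji (combH _)) => s'.
    by rewrite pairingG; have /rowP/(_ s') := vG; rewrite !mxE.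
  apply/rowP => r; rewrite mxE; apply: (phi_free (fun r => v 0 r)).
  apply/funext => x; rewrite comb_funE.
  case: (pselect (F x)) => Fx; last first.
    apply: big1 => r' _; have [p [_ ->]] := phiF r'.
    by rewrite restrictE0 memNset//; exact: mulr0.
  have /(congr1 (fun f => f x)) := v0; rewrite comb_funE => vQ.
  rewrite -[RHS]vQ; apply: eq_bigr => r' _.
  by have [_ ->] := QP r'.
exists (\sum_r invmx G s r *: Q r); first exact: combH.
move=> s'; rewrite pairingG; have /matrixP/(_ s s') := mulVmx Gunit.
by rewrite !mxE.
Qed.

(** Both sides have the same pairings with the basis. *)
Lemma dual_expansion j q (qd : 'I_N -> 'cV[R]_d.+1 -> R^o) : j != i -> H q ->
  (forall s, H (qd s)) ->
  (forall s s', pairing j (qd s) (phi s') = (s == s')%:R) ->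
  q = \sum_s pairing j q (phi s) *: qd s.
Proof.
move=> ji qH qdH qdP; apply: (pairing_dual_ext ji qH).
  by apply: lin_span_sum => s _; exact: lin_spanZ (qdH s).
move=> s; rewrite pairing_suml//; last exact: basis_polynomial_on_face.
rewrite (bigD1 s)//= qdP eqxx mulr1 big1 ?addr0// => s' /negbTE ss'.
by rewrite qdP ss' mulr0.
Qed.

(** * Degrees of freedom of face bubbles *)

Section dof.
Context (nu : 'cV[R]_d.+1).
Local Notation t := (unit_tangent a i).

Lemma face_dofE h (m : 'I_d.+1) (tau : 'cV[R]_d.+1 -> 'M[R]_d.+1) :
  face_dof a i nu h m tau =
  face_integral a i (fun x => h x * (tau x *m nu) m 0).
Proof.
by congr face_integral; apply/funext => x; rewrite dotZl dot_std_unit.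
Qed.

Lemma bubble_normal_component (q : 'I_d.+2 -> 'cV[R]_d.+1 -> R^o)
    (m : 'I_d.+1) x :
  ((\sum_(j | j != i) (lam j x * q j x) *: (t j *m (t j)^T)) *m nu) m 0 =
  \sum_(j | j != i) (dot (t j) nu * t j m 0) * (lam j x * q j x).
Proof.
rewrite mulmx_suml summxE; apply: eq_bigr => j _.
by rewrite -scalemxAl mul_tensor_vec !mxE mulrC.
Qed.

(** Each tensor [t *m t^T] sends the normal to [dot t nu *: t], so a bubble
    contributes to the m-th degree of freedom through the m-th coordinates of
    the tangents only. *)
Lemma face_dof_bubble s m (q : 'I_d.+2 -> 'cV[R]_d.+1 -> R^o) :
  (forall j, j != i -> H (q j)) ->
  face_dof a i nu (phi s) m
    (fun x => \sum_(j | j != i) (lam j x * q j x) *: (t j *m (t j)^T)) =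
  face_measure a i * \sum_(j | j != i)
    dot (t j) nu * t j m 0 * pairing j (q j) (phi s).
Proof.
move=> qH; rewrite face_dofE.
have sF := basis_polynomial_on_face s.
have qsF j : j != i -> polynomial_on F (fun x => lam j x * q j x * phi s x).
  move=> ji; apply: polynomial_onM => //; apply: polynomial_onM.
    exact: barycentric_polynomial_on_face.
  by apply: bary_homog_polynomial_on_face; exact: qH.
transitivity (face_integral a i (fun x => \sum_(j | j != i)
    dot (t j) nu * t j m 0 * (lam j x * q j x * phi s x))).
  apply: eq_simplex_integral => x _; rewrite bubble_normal_component mulr_sumr.
  by apply: eq_bigr => j _; rewrite mulrC !mulrA.
rewrite /face_integral simplex_integral_sum => [|j ji]; last first.
  by apply: polynomial_onM; [exact: polynomial_on_cst|exact: qsF].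
rewrite mulr_sumr; apply: eq_bigr => j ji.
rewrite simplex_integralZ; last exact: qsF.
by rewrite /pairing [RHS]mulrCA (mulVKf face_neq0).
Qed.

Lemma face_dof_sum s m (I : finType) (c : I -> R)
    (tau : I -> 'cV[R]_d.+1 -> 'M[R]_d.+1) :
  (forall r, face_bubbles a lam i k (tau r)) ->
  face_dof a i nu (phi s) m (\sum_r c r *: tau r) =
  \sum_r c r * face_dof a i nu (phi s) m (tau r).
Proof.
move=> tauH; under [in RHS]eq_bigr do rewrite face_dofE.
rewrite face_dofE /face_integral.
have tauF r : polynomial_on F (fun x => phi s x * (tau r x *m nu) m 0).
  apply: polynomial_onM; first exact: basis_polynomial_on_face.
  have [q [qH ->]] := tauH r.
  under eq_fun do rewrite bubble_normal_component.
  apply: polynomial_on_sum => j ji; apply: polynomial_onM.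
    exact: polynomial_on_cst.
  apply: polynomial_onM; first exact: barycentric_polynomial_on_face.
  by apply: bary_homog_polynomial_on_face; exact: qH.
under [in RHS]eq_bigr do rewrite -simplex_integralZ//.
rewrite -simplex_integral_sum => [|r _]; last first.
  by apply: polynomial_onM => //; exact: polynomial_on_cst.
apply: eq_simplex_integral => x _.
rewrite fct_sumE mulmx_suml summxE mulr_sumr; apply: eq_bigr => r _.
by rewrite /= -scalemxAl mxE mulrCA.
Qed.

Lemma face_dof0 s m : face_dof a i nu (phi s) m 0 = 0.
Proof.
rewrite face_dofE -[RHS](simplex_integral0 (face_vertices a i)).
by apply: eq_simplex_integral => x _; rewrite mul0mx mxE mulr0.
Qed.

End dof.

End duality.

(** * The dual basis of the face bubbles *)

(* The dimension of the space is d.+1. *)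
Theorem theorem2p9 (R : realType) (d k : nat) (hd : (2 <= d.+1)%N)
    (a : 'I_d.+2 -> 'cV[R]_d.+1) (ha : affinely_independent a)
    (lam : 'I_d.+2 -> 'cV[R]_d.+1 -> R) (hlam : barycentric a lam)
    (i : 'I_d.+2)
    (nu : 'cV[R]_d.+1) (hnu : unit_normal (face a i) nu)
    (phi : 'I_('C(d + k, k)) -> 'cV[R]_d.+1 -> R^o)
    (hphi : is_basis (poly_on (face a i) k) phi)
    (hphi1 : forall t,
       (face_measure a i)^-1 * face_integral a i (fun x => phi t x ^+ 2) = 1)
    (alpha : 'I_d.+1 -> 'I_d.+2 -> R)
    (halpha : forall l,
       \sum_(j | j != i) alpha l j *: unit_tangent a i j = std_unit R l) :
  let dual (j : 'I_d.+2) (s : 'I_('C(d + k, k))) (q : 'cV[R]_d.+1 -> R^o) :=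
    bary_homog (conv_hull a) lam i k q /\
    forall t, (face_measure a i)^-1 *
      face_integral a i (fun x => lam j x * q x * phi t x) = (s == t)%:R in
  (forall j s, j != i -> exists! q, dual j s q) /\
  (forall q : 'I_d.+2 -> 'I_('C(d + k, k)) -> 'cV[R]_d.+1 -> R^o,
     (forall j s, j != i -> dual j s (q j s)) ->
     let shape s l := face_shape a lam i nu (alpha l) (fun j => q j s) in
     is_basis (face_bubbles a lam i k)
       (fun sl : 'I_('C(d + k, k)) * 'I_d.+1 => shape sl.1 sl.2) /\
     (forall s t l m,
        face_dof a i nu (phi t) m (shape s l) = (s == t)%:R * (l == m)%:R)).
Proof.
have N0 : (0 < 'C(d + k, k))%N by rewrite bin_gt0 leq_addl.
(* The inverse of 0 is 0, so the normalization of phi excludes a face of measure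
   zero. *)
have fm0 : face_measure a i != 0.
  apply/eqP => f0; have /eqP := hphi1 (Ordinal N0).
  by rewrite f0 invr0 mul0r eq_sym oner_eq0.
have phiF := basis_polynomial_on_face hphi.
move=> dual; split=> [j s ji|q qP shape].
  have [q qH qs] := dual_exists ha hlam hphi fm0 s ji.
  exists q; split; first by split.
  move=> q' [q'H q's]; apply: (pairing_dual_ext ha hlam hphi fm0 ji qH q'H).
  by move=> s'; rewrite qs -q's.
have qH j s : j != i -> bary_homog (conv_hull a) lam i k (q j s).
  by move=> ji; have [] := qP j s ji.
have q_dual j s s' : j != i ->
    pairing a lam i j (q j s) (phi s') = (s == s')%:R.
  by move=> ji; have [_] := qP j s ji; apply.
set t := unit_tangent a i in halpha *.
set fm := face_measure a i in fm0 *.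
have tnu0 j : j != i -> dot (t j) nu != 0.
  exact: tangent_dot_normal_neq0 hnu halpha j.
pose coef l j := fm^-1 * (alpha l j / dot (t j) nu).
have shapeE s l : shape s l = fun x =>
    \sum_(j | j != i) (lam j x * (coef l j *: q j s) x) *: (t j *m (t j)^T).
  apply/funext => x; rewrite /shape /face_shape scaler_sumr.
  apply: eq_bigr => j ji; rewrite scalerA; congr (_ *: _).
  rewrite -[(coef l j *: q j s) x]/(coef l j * q j s x) /coef -/fm -/t.
  by ring.
have shapeH s l : face_bubbles a lam i k (shape s l).
  exists (fun j => coef l j *: q j s); split; last exact: shapeE.
  by move=> j ji; apply: lin_spanZ (qH j s ji).
have dofP s s' l m :
    face_dof a i nu (phi s') m (shape s l) = (s == s')%:R * (l == m)%:R.
  rewrite shapeE (face_dof_bubble ha hlam hphi fm0); last first.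
    by move=> j ji; apply: lin_spanZ (qH j s ji).
  have -> : (l == m)%:R = \sum_(j | j != i) alpha l j * t j m 0.
    have := congr1 (fun v : 'cV[R]_d.+1 => v m 0) (halpha l).
    rewrite summxE mxE andbT eq_sym => <-.
    by apply: eq_bigr => j _; rewrite mxE.
  rewrite !mulr_sumr; apply: eq_bigr => j ji.
  rewrite (pairingZ ha hlam _ _ (qH j s ji))//.
  rewrite q_dual// -/t -/fm /coef.
  by field; rewrite fm0 tnu0.
split=> //; split=> [[s l]|c c0 [s m]|tau [q0 [q0H ->]]] //=.
  (* Duality extracts each coefficient of a vanishing combination. *)
  have := face_dof_sum ha hlam hphi nu s m c (fun r => shapeH r.1 r.2).
  rewrite c0 face_dof0 (bigD1 (s, m))//= dofP !eqxx !mulr1 big1 ?addr0//.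
  move=> [s' l] /=; rewrite xpair_eqE negb_and dofP.
  by case/orP => /negbTE ->; rewrite ?mul0r ?mulr0.
(* Spanning: the coefficients c are the degrees of freedom of the bubble, as
   computed by face_dof_bubble. *)
pose P j s := pairing a lam i j (q0 j) (phi s).
pose c (sl : 'I_('C(d + k, k)) * 'I_d.+1) :=
  fm * \sum_(p | p != i) P p sl.1 * dot (t p) nu * t p sl.2 0.
have cE s j : j != i -> \sum_l c (s, l) * coef l j = P j s.
  move=> ji.
  transitivity (\sum_(p | p != i) P p s * dot (t p) nu / dot (t j) nu *
      \sum_l t p l 0 * alpha l j).
    under [RHS]eq_bigr do rewrite mulr_sumr.
    rewrite exchange_big/=; apply: eq_bigr => l _.
    rewrite /c/= mulr_sumr mulr_suml; apply: eq_bigr => p pi.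
    by rewrite /coef; field; rewrite fm0 tnu0.
  rewrite (bigD1 j)//= (tangent_coef_inverse halpha ji ji) eqxx mulr1.
  rewrite mulfK ?tnu0// big1 ?addr0// => p /andP[pi /negbTE pj].
  by rewrite (tangent_coef_inverse halpha pi ji) pj mulr0.
exists c; apply/funext => x; rewrite fct_sumE.
transitivity (\sum_sl c sl *: (\sum_(j | j != i)
    (lam j x * (coef sl.2 j * q j sl.1 x)) *: (t j *m (t j)^T))); last first.
  by apply: eq_bigr => -[s l] _; rewrite shapeE.
under [RHS]eq_bigr do rewrite scaler_sumr.
rewrite [RHS]exchange_big/=; apply: eq_bigr => j ji.
under [RHS]eq_bigr do rewrite scalerA.
rewrite -scaler_suml; congr (_ *: _).
rewrite [in LHS](dual_expansion ha hlam hphi fm0 ji (q0H j ji)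
  (fun s => qH j s ji) (fun s s' => q_dual j s s' ji)).
rewrite comb_funE mulr_sumr.
rewrite -(pair_bigA _
  (fun s l => c (s, l) * (lam j x * (coef l j * q j s x))))/=.
apply: eq_bigr => s _; rewrite -/(P j s) -cE// mulr_suml mulr_sumr.
by apply: eq_bigr => l _; ring.
Qed.
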